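(* For each Banach algebra $A$, the unconditional unitization $A^\flat$ of $A$ is not biamenable.
   Context: The unconditional unitization of $A$ is the Banach algebra $A^\flat=A\oplus\mathbb{C}$ (a new identity is adjoined whether or not $A$ already has one) with product $(a,\alpha)(b,\beta)=(ab+\alpha b+\beta a,\alpha\beta)$ and norm $\|(a,\alpha)\|=\|a\|+|\alpha|$. For a Banach algebra $B$, a Banach $B$-bimodule is a Banach space $X$ which is a $B$-bimodule with continuous module operations. Its dual $X^*$ is a Banach $B$-bimodule via $(b\cdot f)(x)=f(xb)$ and $(f\cdot b)(x)=f(bx)$. A derivation $d:B\to X$ is a bounded linear map with $d(ab)=d(a)b+a\,d(b)$. A biderivation $D:B\times B\to X$ is a bounded bilinear map such that for all $a,b\in B$ the maps $D(a,\cdot)$ and $D(\cdot,b)$ are derivations $B\to X$. Put $Z(B,X)=\{x\in X: bx=xb\ \ \forall b\in B\}$. For $x\in Z(B,X)$ the map $\Delta_x(a,b)=x[a,b]=x(ab-ba)$ is called an inner biderivation. $B$ is called biamenable if for every Banach $B$-bimodule $X$ every biderivation $D:B\times B\to X^*$ is inner, i.e. $D=\Delta_\phi$ for some $\phi\in Z(B,X^* )$. *)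

(* Defs.v *)
From HB Require Import structures.
From mathcomp Require Import all_boot all_order all_algebra.
From mathcomp Require Import all_classical all_reals.
From mathcomp Require Import topology normedtype.
From mathcomp Require Import sequences derive.
From mathcomp Require Import complex.

Set Implicit Arguments.
Unset Strict Implicit.
Unset Printing Implicit Defensive.

Import Order.TTheory GRing.Theory Num.Theory.
Import numFieldNormedType.Exports.

Local Open Scope classical_set_scope.
Local Open Scope complex_scope.
Local Open Scope ring_scope.

(* Complex scalars are R[i] for R : realType.  Norms of normed spaces over R[i]
   take their values in R[i] itself; they are nonnegative, hence real. *)

HB.mixin Record isBanachAlgebra (R : realType) A
    & CompleteNormedModule R[i] A := {
  bmul : A -> A -> A;
  bmulA : associative bmul;
  bmul_bilinear : bilinear_for *:%R *:%R bmul;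
  norm_bmul : forall a b, `|bmul a b| <= `|a| * `|b|
}.

(* Neither commutative nor unital in general. *)
#[short(type="banachAlgType")]
HB.structure Definition BanachAlgebra (R : realType) :=
  {A of isBanachAlgebra R A & CompleteNormedModule R[i] A}.

(* If B has an identity element, it is not required to act as the identity. *)
HB.mixin Record isBanachBimodule (R : realType) (B : banachAlgType R) X
    & CompleteNormedModule R[i] X := {
  lact : B -> X -> X;
  ract : X -> B -> X;
  lact_bilinear : bilinear_for *:%R *:%R lact;
  ract_bilinear : bilinear_for *:%R *:%R ract;
  lactM : forall a b x, lact (bmul a b) x = lact a (lact b x);
  ractM : forall x a b, ract x (bmul a b) = ract (ract x a) b;
  lractA : forall a x b, ract (lact a x) b = lact a (ract x b);
  lact_continuous : continuous (fun p : B * X => lact p.1 p.2);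
  ract_continuous : continuous (fun p : X * B => ract p.1 p.2)
}.

#[short(type="banachBimodType")]
HB.structure Definition BanachBimodule (R : realType) (B : banachAlgType R) :=
  {X of isBanachBimodule R B X & CompleteNormedModule R[i] X}.

Section BilinearFacts.
Variables (R : realType) (U V W : normedModType R[i]) (f : U -> V -> W).
Hypothesis bf : bilinear_for *:%R *:%R f.

Let fB := bilinear_isBilinear.Build R[i] U V W *:%R *:%R f bf.
HB.instance Definition _ := fB.

Lemma bilinear_continuous_bounded :
  continuous (fun p : U * V => f p.1 p.2) ->
  exists2 k : R[i], 0 < k & forall u v, `|f u v| <= k * `|u| * `|v|.
Proof. exact: (@bilinear_schwarz _ U V W f). Qed.

Lemma bilinear_bounded_continuous (k : R[i]) :
  0 < k -> (forall u v, `|f u v| <= k * `|u| * `|v|) ->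
  continuous (fun p : U * V => f p.1 p.2).
Proof.
move=> k0 fk [u v] /=; apply/cvgrPdist_lt => e e0 /=.
have u1 : 0 < `|u| + 1 :> R[i] by rewrite ltr_wpDl.
have v1 : 0 < `|v| + 1 :> R[i] by rewrite ltr_wpDl.
have cu : (fun p : U * V => p.1) @ (u, v) --> u by exact: cvg_fst.
have cv : (fun p : U * V => p.2) @ (u, v) --> v by exact: cvg_snd.
near=> p.
have pu : `|u - p.1| < e / 2 / (k * (`|v| + 1)).
  by near: p; move/cvgrPdist_lt: cu; apply; rewrite !divr_gt0// mulr_gt0.
have pu1 : `|u - p.1| < 1.
  by near: p; move/cvgrPdist_lt: cu; apply.
have pv : `|v - p.2| < e / 2 / (k * (`|u| + 1)).
  by near: p; move/cvgrPdist_lt: cv; apply; rewrite !divr_gt0// mulr_gt0.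
have -> : f u v - f p.1 p.2 = f (u - p.1) v + f p.1 (v - p.2).
  by rewrite (linearBl f) (linearBr f) addrA subrK.
have p1M : `|p.1| <= `|u| + 1.
  by rewrite -[p.1](subKr u) (le_trans (ler_normB _ _))// lerD2l ltW.
rewrite (le_lt_trans (ler_normD _ _))// [e]splitr ltrD//.
  rewrite (le_lt_trans (fk _ _))// mulrAC.
  rewrite (@le_lt_trans _ _ (k * (`|v| + 1) * `|u - p.1|))//.
    by rewrite ler_wpM2r// ler_pM2l// lerDl.
  by rewrite mulrC -ltr_pdivlMr// mulr_gt0.
rewrite (le_lt_trans (fk _ _))//.
rewrite (@le_lt_trans _ _ (k * (`|u| + 1) * `|v - p.2|))//.
  by rewrite ler_wpM2r// ler_pM2l.
by rewrite mulrC -ltr_pdivlMr// mulr_gt0.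
Unshelve. all: by end_near. Qed.

End BilinearFacts.

Section ComplexComplete.
Variable R : realType.

Let normc_real (a : R) : `|a%:C| = `|a|%:C :> R[i].
Proof. by rewrite normc_def/= expr0n addr0 sqrtr_sqr. Qed.

Let normci : `|'i : R[i]| = 1.
Proof. by rewrite normc_def/= expr0n expr1n add0r sqrtr1. Qed.

Lemma norm_complexE (z : R[i]) : `|z| = (Normc.normc z)%:C.
Proof. by []. Qed.

Lemma complex_complete (F : set_system R[i]^o) :
  ProperFilter F -> cauchy F -> cvg F.
Proof.
move=> FF /cauchyP Fc.
have cauchyRI (h : R[i] -> R) : (forall z, `|h z|%:C <= `|z|) ->
    {morph h : x y / x - y} -> cvg (h @ F).
  move=> hle hB; apply/cauchy_cvgP/cauchyP => e e0.
  have [|z Fz] := Fc e%:C; first by rewrite ltcR.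
  exists (h z); apply: (@filterS _ F _ (ball z e%:C)) Fz => w /=.
  rewrite -!ball_normE => /= zw.
  by rewrite /ball_/= -hB -ltcR (le_lt_trans (hle _)).
have /cvg_ex[a Fa] := cauchyRI (@complex.Re R) (@normc_ge_Re R) (fun x y => raddfB _ x y).
have /cvg_ex[b Fb] : cvg ((@complex.Im R : R[i] -> R) @ F).
  apply: cauchyRI; last by move=> [? ?] [? ?].
  by move=> z; have := normc_ge_Re (z * 'i); rewrite ReiNIm normrN normrM normci mulr1.
apply/cvg_ex; exists (a +i* b); apply/cvgrPdist_lt => e e0.
have [e' e'0 ->] : exists2 e' : R, 0 < e' & e = e'%:C.
  have er : (complex.Re e)%:C = e by rewrite RRe_real// gtr0_real.
  by exists (complex.Re e) => //; rewrite -ltcR er.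
have e2 : 0 < e' / 2 by rewrite divr_gt0.
near=> z.
have za : `|a - complex.Re z| < e' / 2 by near: z; move/cvgrPdist_lt: Fa; apply.
have zb : `|b - complex.Im z| < e' / 2 by near: z; move/cvgrPdist_lt: Fb; apply.
have -> : (a +i* b) - z = (a - complex.Re z)%:C + 'i * (b - complex.Im z)%:C.
  by case: (z) => c d; rewrite [LHS]complexE.
rewrite (le_lt_trans (ler_normD _ _))// normrM normci mul1r.
by rewrite !normc_real// -rmorphD ltcR [ltRHS]splitr ltrD.
Unshelve. all: by end_near. Qed.

End ComplexComplete.

(* A fresh name for the product, because the library equips A * R[i] with the
   sup norm, not with the sum norm used below. *)
Definition unitization (R : realType) (A : banachAlgType R) : Type :=
  (A * R[i])%type.

Section Unitization.
Variables (R : realType) (A : banachAlgType R).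
Local Notation Au := (unitization A).

HB.instance Definition _ := GRing.Lmodule.copy Au (A * R[i]^o)%type.

Definition unitization_norm (x : Au) : R[i] := `|x.1| + `|x.2|.

Definition unitization_mul (x y : Au) : Au :=
  (bmul x.1 y.1 + x.2 *: y.1 + y.2 *: x.1, x.2 * y.2).

Let normD (x y : Au) :
  unitization_norm (x + y) <= unitization_norm x + unitization_norm y.
Proof. by rewrite /unitization_norm addrACA lerD// ler_normD. Qed.

Let normZ (l : R[i]) (x : Au) :
  unitization_norm (l *: x) = `|l| * unitization_norm x.
Proof. by rewrite /unitization_norm /= normrZ normrM -mulrDr. Qed.

Let norm0_eq0 (x : Au) : unitization_norm x = 0 -> x = 0.
Proof.
move/eqP; rewrite paddr_eq0// !normr_eq0 => /andP[/eqP x1 /eqP x2].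
by case: x x1 x2 => /= a b -> ->.
Qed.

HB.instance Definition _ :=
  Lmodule_isNormed.Build R[i] Au normD normZ norm0_eq0.

Lemma unitization_normE (x : Au) : `|x| = `|x.1| + `|x.2|.
Proof. by []. Qed.

Let complete (F : set_system Au) : ProperFilter F -> cauchy F -> cvg F.
Proof.
move=> FF /cauchyP Fc.
have /cvg_ex[a Fa] : cvg ((fun x : Au => x.1) @ F).
  apply/cauchy_cvgP/cauchyP => e e0; have [z Fz] := Fc _ e0.
  exists z.1; apply: (@filterS _ F _ (ball z e)) Fz => w.
  rewrite -!ball_normE /ball_/=; apply: le_lt_trans.
  by rewrite unitization_normE lerDl.
have /cvg_ex[b Fb] : cvg ((fun x : Au => x.2 : R[i]^o) @ F).
  apply: complex_complete; apply/cauchyP => e e0; have [z Fz] := Fc _ e0.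
  exists z.2; apply: (@filterS _ F _ (ball z e)) Fz => w.
  rewrite -!ball_normE /ball_/=; apply: le_lt_trans.
  by rewrite unitization_normE lerDr.
apply/cvg_ex; exists (a, b); apply/cvgrPdist_lt => e e0.
have e2 : 0 < e / 2 by rewrite divr_gt0.
near=> z; rewrite unitization_normE [e]splitr ltrD//=.
  by near: z; move/cvgrPdist_lt: Fa; apply.
by near: z; move/cvgrPdist_lt: Fb; apply.
Unshelve. all: by end_near. Qed.

HB.instance Definition _ := Uniform_isComplete.Build Au complete.

Let Ab := bilinear_isBilinear.Build R[i] A A A *:%R *:%R bmul bmul_bilinear.
HB.instance Definition _ := Ab.

Let mulA : associative unitization_mul.
Proof.
move=> [a al] [b be] [c ga]; rewrite /unitization_mul/=; congr (_, _); last first.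
  by rewrite mulrA.
rewrite !(linearDl (@bmul R A)) !(linearDr (@bmul R A)) !scalerDr !scalerA.
rewrite !(linearZl_LR (@bmul R A)) !(linearZr_LR (@bmul R A))/= bmulA !addrA.
by rewrite [ga * al]mulrC [ga * be]mulrC [RHS](ACl (1*3*5*2*4*6*7)).
Qed.

Let mul_bilinear : bilinear_for *:%R *:%R unitization_mul.
Proof.
split=> [[b be]|[a al]] k [x xi] [y yi]; congr (_, _) => /=.
- rewrite linearDl linearZl_LR scalerDl !scalerDr !scalerA !addrA.
  by rewrite [be * k]mulrC [LHS](ACl (1*3*5*2*4*6)).
- by rewrite mulrDl; congr +%R; rewrite -[LHS]mulrA.
- rewrite linearDr linearZr_LR scalerDl !scalerDr !scalerA !addrA.
  by rewrite [al * k]mulrC [LHS](ACl (1*3*5*2*4*6)).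
- by rewrite mulrDr; congr +%R; rewrite [LHS]mulrCA.
Qed.

Let norm_mul (x y : Au) : `|unitization_mul x y| <= `|x| * `|y|.
Proof.
rewrite !unitization_normE /= mulrDl !mulrDr addrA normrM lerD2r.
rewrite (le_trans (ler_normD _ _))// normrZ [`|x.1| * `|y.2|]mulrC.
rewrite [leRHS]addrAC lerD2r (le_trans (ler_normD _ _))// normrZ.
by rewrite lerD2r norm_bmul.
Qed.

HB.instance Definition _ :=
  isBanachAlgebra.Build R Au mulA mul_bilinear norm_mul.

End Unitization.

Section Dual.
Variables (R : realType) (X : normedModType R[i]).

Definition dual_pred : {pred X -> R[i]^o} :=
  fun f => `[< linear f /\ continuous f >].

Record dual := Dual {
  dual_fun :> X -> R[i]^o;
  dual_funP : dual_fun \in dual_pred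
}.

HB.instance Definition _ := [isSub for dual_fun].
HB.instance Definition _ := [Choice of dual by <:].

Let dual_submod_closed : submod_closed dual_pred.
Proof.
split.
  apply/asboolP; split; last exact: cst_continuous.
  by move=> a x y /=; rewrite scaler0 addr0.
move=> a f g /asboolP[lf cf] /asboolP[lg cg]; apply/asboolP; split.
  move=> k x y; rewrite /= -![(a *: f + g) _]/(a *: f _ + g _) lf lg.
  rewrite !scalerDr !scalerA [a * k]mulrC -!addrA; congr +%R.
  by rewrite addrCA.
move=> x; apply: cvgD; last exact: cg.
by apply: cvgZr; exact: cf.
Qed.

HB.instance Definition _ := GRing.isSubmodClosed.Build _ _ dual_pred
  dual_submod_closed.
HB.instance Definition _ := [SubChoice_isSubLmodule of dual by <:].

Lemma dual_linear (f : dual) : linear f.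
Proof. by have /asboolP[] := dual_funP f. Qed.

Lemma dual_continuous (f : dual) : continuous f.
Proof. by have /asboolP[] := dual_funP f. Qed.

HB.instance Definition _ (f : dual) :=
  GRing.isLinear.Build R[i] X R[i]^o _ f (dual_linear f).

Definition opnorm (f : dual) : R[i] :=
  (sup [set Normc.normc (f x) | x in [set x | `|x| <= 1]])%:C.

Lemma dual_bounded (f : dual) :
  exists2 k : R, 0 < k & forall x, `|f x| <= k%:C * `|x|.
Proof.
have : bounded_near f (nbhs (0 : X)).
  apply/linear_bounded_continuous; exact: dual_continuous.
move/linear_boundedP/pinfty_ex_gt0 => [r r0 fr].
have er : (complex.Re r)%:C = r by rewrite RRe_real// gtr0_real.
by exists (complex.Re r); [rewrite -ltcR er|rewrite er].
Qed.


Let unit_image (f : dual) := [set Normc.normc (f x) | x in [set x | `|x| <= 1]].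

Let unit_imageP (f : dual) : has_sup (unit_image f).
Proof.
split; first by exists (Normc.normc (f 0)), 0 => //=; rewrite normr0.
have [k k0 fk] := dual_bounded f; exists k => _ [x /= x1 <-].
rewrite -lecR -norm_complexE (le_trans (fk x))//.
by rewrite -[leRHS]mulr1 ler_pM2l// ltcR.
Qed.

Lemma opnorm_le (f : dual) (k : R[i]) :
  0 <= k -> (forall x, `|f x| <= k * `|x|) -> opnorm f <= k.
Proof.
move=> k0 fk; have er : (complex.Re k)%:C = k by rewrite RRe_real// ger0_real.
rewrite /opnorm -er lecR; apply: ge_sup; first by have [] := unit_imageP f.
move=> _ [x /= x1 <-]; rewrite -lecR -norm_complexE er (le_trans (fk x))//.
by rewrite -[leRHS]mulr1 ler_wpM2l.
Qed.

Lemma le_opnorm (f : dual) x : `|f x| <= opnorm f * `|x|.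
Proof.
have [->|x0] := eqVneq x 0; first by rewrite linear0 !normr0 mulr0.
have nx0 : 0 < `|x| by rewrite normr_gt0.
rewrite -ler_pdivrMr//.
have -> : `|f x| / `|x| = `|f (`|x|^-1 *: x)|.
  by rewrite linearZ normrZ ger0_norm ?invr_ge0// mulrC.
rewrite norm_complexE lecR; apply: ub_le_sup; first by have [] := unit_imageP f.
exists (`|x|^-1 *: x) => //=.
by rewrite normrZ ger0_norm ?invr_ge0// mulVf// gt_eqF.
Qed.

Lemma opnorm_ge0 (f : dual) : 0 <= opnorm f.
Proof.
rewrite lecR; apply: ub_le_sup; first by have [] := unit_imageP f.
by exists 0; rewrite /= ?linear0 ?Normc.normc0 ?normr0.
Qed.

Let dualD (f g : dual) x : (f + g) x = f x + g x.
Proof. by []. Qed.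

Let dualB (f g : dual) x : (f - g) x = f x - g x.
Proof. by []. Qed.

Let dualZ (k : R[i]) (f : dual) x : (k *: f) x = k * f x.
Proof. by []. Qed.

Let opnormD (f g : dual) : opnorm (f + g) <= opnorm f + opnorm g.
Proof.
apply: opnorm_le => [|x]; first by rewrite addr_ge0// opnorm_ge0.
by rewrite dualD (le_trans (ler_normD _ _))// mulrDl lerD// le_opnorm.
Qed.

Let opnormZ_le (k : R[i]) (f : dual) : opnorm (k *: f) <= `|k| * opnorm f.
Proof.
apply: opnorm_le => [|x]; first by rewrite mulr_ge0// opnorm_ge0.
by rewrite dualZ normrM -mulrA ler_wpM2l// le_opnorm.
Qed.

Let opnormZ (k : R[i]) (f : dual) : opnorm (k *: f) = `|k| * opnorm f.
Proof.
apply: le_anti; rewrite opnormZ_le/=.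
have [->|k0] := eqVneq k 0; first by rewrite normr0 mul0r opnorm_ge0.
rewrite -ler_pdivlMl ?normr_gt0// -normfV (le_trans _ (opnormZ_le _ _))//.
by rewrite scalerA mulVf// scale1r.
Qed.

Let opnorm_eq0 (f : dual) : opnorm f = 0 -> f = 0.
Proof.
move=> f0; apply/val_inj/funext => x; apply/eqP.
by rewrite -normr_le0 (le_trans (le_opnorm _ _))// f0 mul0r.
Qed.

HB.instance Definition _ :=
  Lmodule_isNormed.Build R[i] dual opnormD opnormZ opnorm_eq0.

Lemma dual_normE (f : dual) : `|f| = opnorm f.
Proof. by []. Qed.

Let complete (F : set_system dual) : ProperFilter F -> cauchy F -> cvg F.
Proof.
move=> FF /cauchyP Fc.
have cvx x : cvg ((fun f : dual => f x) @ F).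
  apply: complex_complete; apply/cauchyP => e e0.
  have x1 : 0 < `|x| + 1 :> R[i] by rewrite ltr_wpDl.
  have [|f0 Ff0] := Fc (e / (`|x| + 1)); first by rewrite divr_gt0.
  exists (f0 x); apply: (@filterS _ F _ (ball f0 (e / (`|x| + 1)))) Ff0 => f.
  rewrite -!ball_normE /ball_/= ltr_pdivlMr// => f0f.
  rewrite -dualB (le_lt_trans (le_opnorm _ _))// (le_lt_trans _ f0f)//.
  by apply: ler_wpM2l; [exact: opnorm_ge0|rewrite lerDl].
pose g x : R[i]^o := lim ((fun f : dual => f x) @ F).
have Fg x : (fun f : dual => f x) @ F --> g x by exact: cvx.
have gl : linear g.
  move=> k x y; apply: (@cvg_unique R[i]^o) (Fg _) _ => //.
  have -> : (fun f : dual => f (k *: x + y)) = (fun f : dual => k *: f x + f y).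
    by apply/funext => f; rewrite linearP.
  by apply: cvgD; [apply: cvgZr|]; exact: Fg.
have gF e : 0 < e -> exists2 f0 : dual, F (ball f0 e) &
    forall x, `|f0 x - g x| <= e * `|x|.
  move=> e0; have [f0 Ff0] := Fc _ e0; exists f0 => // x.
  apply/ler_addgt0Pr => d d0; near F => f.
  have f0f : ball f0 e f by near: f.
  have fg : `|g x - f x| < d by near: f; move/cvgrPdist_lt: (Fg x); apply.
  rewrite -(subrKA (f x)) (le_trans (ler_normD _ _))// lerD//; last first.
    by rewrite distrC ltW.
  by rewrite -dualB (le_trans (le_opnorm _ _))// ler_wpM2r// ltW//.
have gc : continuous g.
  pose gL : {linear X -> R[i]^o} := HB.pack g (GRing.isLinear.Build _ _ _ _ g gl).
  apply: (@bounded_linear_continuous _ _ _ gL); apply/linear_boundedP.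
  have [f0 _ f0g] := gF 1 ltr01.
  have k0 : 0 <= opnorm f0 + 1 by rewrite addr_ge0// opnorm_ge0.
  near=> r => x; apply: (@le_trans _ _ ((opnorm f0 + 1) * `|x|)); last first.
    by apply: ler_wpM2r => //; near: r; apply: nbhs_pinfty_ge; exact: ger0_real.
  rewrite -[X in `|X|](subKr (f0 x)) (le_trans (ler_normB _ _))//.
  by rewrite mulrDl lerD// le_opnorm.
have gP : g \in dual_pred by apply/asboolP.
apply/cvg_ex; exists (Dual gP); apply/cvgrPdist_le => e e0.
have e2 : 0 < e / 2 by rewrite divr_gt0.
have [f0 Ff0 f0g] := gF _ e2.
apply: (@filterS _ F _ (ball f0 (e / 2))) Ff0 => f; rewrite -ball_normE/= => f0f.
rewrite -(subrKA f0) [e]splitr (le_trans (ler_normD _ _))// lerD//; last exact: ltW.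
apply: opnorm_le => [|x]; first exact: ltW.
by rewrite dualB distrC.
Unshelve. all: by end_near. Qed.

HB.instance Definition _ := Uniform_isComplete.Build dual complete.

End Dual.

Section DualBimodule.
Variables (R : realType) (B : banachAlgType R) (X : banachBimodType B).

Let Lb := bilinear_isBilinear.Build R[i] B X X *:%R *:%R lact lact_bilinear.
HB.instance Definition _ := Lb.
Let Rb := bilinear_isBilinear.Build R[i] X B X *:%R *:%R ract ract_bilinear.
HB.instance Definition _ := Rb.

Let lact_fun (b : B) (f : dual X) : X -> R[i]^o := fun x => f (ract x b).
Let ract_fun (f : dual X) (b : B) : X -> R[i]^o := fun x => f (lact b x).

Let lact_funP b f : lact_fun b f \in @dual_pred R X.
Proof.
apply/asboolP; split=> [k x y|].
  by rewrite /lact_fun (linearPl (@ract R B X)) linearP.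
move=> x; apply: (@continuous_comp _ _ _ (fun x : X => ract x b) f).
  apply: (@continuous_comp _ _ _ (fun x : X => (x, b)) (fun p => ract p.1 p.2)).
    by apply: cvg_pair; [exact: cvg_id|exact: cvg_cst].
  exact: ract_continuous.
exact: dual_continuous.
Qed.

Let ract_funP f b : ract_fun f b \in @dual_pred R X.
Proof.
apply/asboolP; split=> [k x y|].
  by rewrite /ract_fun (linearPr (@lact R B X)) linearP.
move=> x; apply: (@continuous_comp _ _ _ (fun x : X => lact b x) f).
  apply: (@continuous_comp _ _ _ (fun x : X => (b, x)) (fun p => lact p.1 p.2)).
    by apply: cvg_pair; [exact: cvg_cst|exact: cvg_id].
  exact: lact_continuous.
exact: dual_continuous.
Qed.

Definition dual_lact (b : B) (f : dual X) : dual X := Dual (lact_funP b f).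
Definition dual_ract (f : dual X) (b : B) : dual X := Dual (ract_funP f b).

Lemma dual_lactE b f x : dual_lact b f x = f (ract x b).
Proof. by []. Qed.

Lemma dual_ractE f b x : dual_ract f b x = f (lact b x).
Proof. by []. Qed.

Let dual_ext (f g : dual X) : (forall x, f x = g x) -> f = g.
Proof. by move=> fg; apply/val_inj/funext. Qed.

Let dual_lact_bilinear : bilinear_for *:%R *:%R dual_lact.
Proof.
split=> [f|b] k u v; apply: dual_ext => x //.
transitivity (k *: f (ract x u) + f (ract x v)) => //.
by rewrite dual_lactE (linearPr (@ract R B X)) linearP.
Qed.

Let dual_ract_bilinear : bilinear_for *:%R *:%R dual_ract.
Proof.
split=> [b|f] k u v; apply: dual_ext => x //.
transitivity (k *: f (lact u x) + f (lact v x)) => //.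
by rewrite dual_ractE (linearPl (@lact R B X)) linearP.
Qed.

Let dual_lactM a b f : dual_lact (bmul a b) f = dual_lact a (dual_lact b f).
Proof. by apply: dual_ext => x; rewrite !dual_lactE ractM. Qed.

Let dual_ractM f a b : dual_ract f (bmul a b) = dual_ract (dual_ract f a) b.
Proof. by apply: dual_ext => x; rewrite !dual_ractE lactM. Qed.

Let dual_lractA a f b :
  dual_ract (dual_lact a f) b = dual_lact a (dual_ract f b).
Proof.
by apply: dual_ext => x; rewrite dual_ractE !dual_lactE dual_ractE lractA.
Qed.

Let dual_lact_continuous :
  continuous (fun p : B * dual X => dual_lact p.1 p.2).
Proof.
have [k k0 rk] :=
  bilinear_continuous_bounded (@ract_bilinear R B X) (@ract_continuous R B X).
apply: (bilinear_bounded_continuous dual_lact_bilinear k0) => b f.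
apply: opnorm_le => [|x]; first by rewrite !mulr_ge0// ltW.
rewrite dual_lactE (le_trans (le_opnorm _ _))//.
apply: (@le_trans _ _ (opnorm f * (k * `|x| * `|b|))).
  by apply: ler_wpM2l; [exact: opnorm_ge0|exact: rk].
by rewrite dual_normE mulrC -!mulrA ler_pM2l// mulrC mulrA -mulrA mulrCA.
Qed.

Let dual_ract_continuous :
  continuous (fun p : dual X * B => dual_ract p.1 p.2).
Proof.
have [k k0 lk] :=
  bilinear_continuous_bounded (@lact_bilinear R B X) (@lact_continuous R B X).
apply: (bilinear_bounded_continuous dual_ract_bilinear k0) => f b.
apply: opnorm_le => [|x]; first by rewrite !mulr_ge0// ltW.
rewrite dual_ractE (le_trans (le_opnorm _ _))//.
apply: (@le_trans _ _ (opnorm f * (k * `|b| * `|x|))).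
  by apply: ler_wpM2l; [exact: opnorm_ge0|exact: lk].
by rewrite dual_normE !mulrA [opnorm f * k]mulrC.
Qed.

HB.instance Definition _ := isBanachBimodule.Build R B (dual X)
  dual_lact_bilinear dual_ract_bilinear dual_lactM dual_ractM dual_lractA
  dual_lact_continuous dual_ract_continuous.

End DualBimodule.

Section Biderivations.
Variables (R : realType) (B : banachAlgType R) (X : banachBimodType B).

Definition derivation (d : B -> X) : Prop :=
  [/\ linear d,
      exists M : R[i], forall a, `|d a| <= M * `|a|
    & forall a b, d (bmul a b) = ract (d a) b + lact a (d b)].

Definition biderivation (D : B -> B -> X) : Prop :=
  [/\ bilinear_for *:%R *:%R D,
      exists M : R[i], forall a b, `|D a b| <= M * `|a| * `|b|,
      forall a, derivation (D a)
    & forall b, derivation (D^~ b)].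

Definition bimodule_center : set X :=
  [set x | forall b : B, lact b x = ract x b].

Definition inner_biderivation (x : X) (a b : B) : X :=
  ract x (bmul a b - bmul b a).

End Biderivations.

Definition biamenable (R : realType) (B : banachAlgType R) : Prop :=
  forall (X : banachBimodType B) (D : B -> B -> dual X), biderivation D ->
    exists2 phi : dual X,
      bimodule_center phi & forall a b, D a b = inner_biderivation phi a b.

(* Main.v *)
From HB Require Import structures.
Require Import Defs.
From mathcomp Require Import all_boot all_order all_algebra.
From mathcomp Require Import all_classical all_reals.
From mathcomp Require Import topology normedtype.
From mathcomp Require Import complex.

(** Let [chi (a, alpha) = alpha] be the canonical character of the unitization
    and let it act on the one-dimensional space by [chi] on the left and by zero
    on the right.  On the dual the left action is zero and the right one is
    [chi], so every multiple of [chi] is a derivation and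
    [(a, b) |-> chi a * chi b] is a biderivation.  It does not vanish at
    [(1, 1)], whereas an inner biderivation vanishes on the diagonal. *)

Set Implicit Arguments.
Unset Strict Implicit.
Unset Printing Implicit Defensive.

Import GRing.Theory Num.Theory.

Local Open Scope ring_scope.

(** A separate type name, indexed by [A], lets the bimodule structure over the unitization of [A] be
    inferred from the type without being attached to [R[i]^o] itself. *)
Definition char_module (R : realType) (A : banachAlgType R) : Type := R[i]^o.

Section CharModule.
Variables (R : realType) (A : banachAlgType R).
Local Notation B := (unitization A).
Local Notation X := (char_module A).

HB.instance Definition _ := NormedModule.copy X R[i]^o.
HB.instance Definition _ :=
  Uniform_isComplete.Build X (@complex_complete R).

Definition char_lact (b : B) (x : X) : X := b.2 *: x.
Definition char_ract (x : X) (b : B) : X := 0.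

Lemma char_lact_bilinear : bilinear_for *:%R *:%R char_lact.
Proof.
split=> [x|b] k u v; rewrite /char_lact/=; first by rewrite scalerDl scalerA.
by rewrite scalerDr !scalerA mulrC.
Qed.

Lemma char_ract_bilinear : bilinear_for *:%R *:%R char_ract.
Proof. by split=> [b|x] k u v; rewrite /char_ract/= scaler0 addr0. Qed.

Lemma char_lactM (a b : B) (x : X) :
  char_lact (bmul a b) x = char_lact a (char_lact b x).
Proof. by rewrite /char_lact scalerA. Qed.

Lemma char_ractM (x : X) (a b : B) :
  char_ract x (bmul a b) = char_ract (char_ract x a) b.
Proof. by []. Qed.

Lemma char_lractA (a : B) (x : X) (b : B) :
  char_ract (char_lact a x) b = char_lact a (char_ract x b).
Proof. by rewrite /char_lact scaler0. Qed.

(** The character is contractive; this bounds both the left action and the biderivation. *)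
Lemma norm_snd_le (b : B) : `|b.2| <= `|b|.
Proof. by rewrite unitization_normE lerDr. Qed.

Lemma char_lact_continuous : continuous (fun p : B * X => char_lact p.1 p.2).
Proof.
apply: (bilinear_bounded_continuous char_lact_bilinear ltr01) => b x.
by rewrite mul1r normrZ ler_wpM2r// norm_snd_le.
Qed.

Lemma char_ract_continuous : continuous (fun p : X * B => char_ract p.1 p.2).
Proof. exact: cst_continuous. Qed.

HB.instance Definition _ := isBanachBimodule.Build R B X
  char_lact_bilinear char_ract_bilinear char_lactM char_ractM char_lractA
  char_lact_continuous char_ract_continuous.

Lemma char_functional_subproof : (idfun : X -> R[i]^o) \in @dual_pred R X.
Proof. by apply/asboolP; split=> // x; exact: cvg_id. Qed.

Definition char_functional : dual X := Dual char_functional_subproof.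

Definition char_biderivation (a b : B) : dual X :=
  (a.2 * b.2) *: char_functional.

(** By symmetry, properties in the second variable carry over to the first. *)
Lemma char_biderivation_sym a b : char_biderivation a b = char_biderivation b a.
Proof. by rewrite /char_biderivation mulrC. Qed.

Lemma char_biderivation_linear a : linear (char_biderivation a).
Proof.
by move=> k u v; rewrite /char_biderivation/= mulrDr scalerDl scalerA mulrCA.
Qed.

Lemma char_biderivation_bounded a b :
  `|char_biderivation a b| <= `|char_functional| * `|a| * `|b|.
Proof.
by rewrite normrZ normrM mulrC -mulrA ler_wpM2l// ler_pM// norm_snd_le.
Qed.

Lemma char_biderivation_derivation a : derivation (char_biderivation a).
Proof.
split; first exact: char_biderivation_linear.
  by exists (`|char_functional| * `|a|) => b; exact: char_biderivation_bounded.
move=> b c; apply/val_inj/funext => x.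
(* Evaluated at [x], the right action of [c] on the dual multiplies the argument by [c.2], while the
   left action of [b] evaluates at [char_ract x b], which is zero. *)
rewrite -[LHS]/(a.2 * (b.2 * c.2) * x).
rewrite -[RHS]/(a.2 * b.2 * (c.2 * x) + a.2 * c.2 * 0).
by rewrite mulr0 addr0 !mulrA.
Qed.

Lemma char_biderivationP : biderivation char_biderivation.
Proof.
have symE b : char_biderivation^~ b = char_biderivation b.
  by apply/funext => a; exact: char_biderivation_sym.
split.
- split=> [b|a]; last exact: char_biderivation_linear.
  by rewrite /= symE; exact: char_biderivation_linear.
- by exists `|char_functional|; exact: char_biderivation_bounded.
- exact: char_biderivation_derivation.
- by move=> b; rewrite symE; exact: char_biderivation_derivation.
Qed.

End CharModule.

Lemma inner_biderivation_diag (R : realType) (B : banachAlgType R)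
  (X : banachBimodType B) (x : X) (a : B) : inner_biderivation x a a = 0.
Proof.
(* Linearity with scalar -1 at zero vectors yields [ract x 0 = 0]. *)
have [_ /(_ x (-1) 0 0)] := @ract_bilinear R B X.
by rewrite /inner_biderivation subrr /= scaler0 addr0 scaleN1r addNr.
Qed.

Theorem theorem3p11 (R : realType) (A : banachAlgType R) :
  ~ biamenable (unitization A).
Proof.
(* The pair [(0, 1)] is the adjoined identity, where the character is 1. *)
move=> /(_ _ _ (char_biderivationP A))[phi _ /(_ (0, 1) (0, 1))].
rewrite inner_biderivation_diag.
move=> /(congr1 (fun f : dual (char_module A) => f (1 : R[i])))/eqP.
by rewrite -[X in X == _]/(1 * 1 * 1) !mulr1 oner_eq0.
Qed.
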